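(* Let $\boldsymbol{\tau}^*$ be a solution to the parameterized optimal control problem for fixed parameters $\theta$. By the first-order optimality conditions (there exist Lagrange multipliers $\boldsymbol{\lambda}^*$ which together with $\boldsymbol{\tau}^*$ form $\boldsymbol{z}^*=(\boldsymbol{\tau}^*,\boldsymbol{\lambda}^* )$ satisfying $\nabla_{\boldsymbol{z}}\mathcal{L}(\boldsymbol{z}^*,\theta)=0$), the implicit function theorem holds with $F=\nabla_{\boldsymbol{z}}\mathcal{L}$. Furthermore, the Jacobian $\frac{\partial\boldsymbol{z}^*}{\partial\theta}$ is given as $$\frac{\partial}{\partial\theta}\boldsymbol{z}^*(\theta)=-\mathcal{L}_{\boldsymbol{z}\boldsymbol{z}}^{-1}\,\mathcal{L}_{\boldsymbol{z}\theta}.$$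
   Context: The parameterized optimal control problem is, for $\theta\in\mathbb{R}^{n_\theta}$ and horizon $N\in\mathbb{N}$, $$\boldsymbol{\tau}^*(\theta)=\arg\min_{\boldsymbol{\tau}}\ \sum_{k=0}^{N-1}\ell(x_k,u_k,\theta)+\phi(x_N,\theta)\quad\text{subject to } x_{k+1}=f(x_k,u_k,\theta),\quad x_0=\xi(\theta),$$ where $\boldsymbol{\tau}=(x_0,u_0,x_1,u_1,\dots,x_N)$ is the state-control trajectory with $x_k\in\mathbb{R}^{n_x}$, $u_k\in\mathbb{R}^{n_u}$; $\xi:\mathbb{R}^{n_\theta}\to\mathbb{R}^{n_x}$ is a differentiable function giving the initial condition; $f:\mathbb{R}^{n_x}\times\mathbb{R}^{n_u}\times\mathbb{R}^{n_\theta}\to\mathbb{R}^{n_x}$ is the parameterized dynamics; and $\ell:\mathbb{R}^{n_x}\times\mathbb{R}^{n_u}\times\mathbb{R}^{n_\theta}\to\mathbb{R}$ and $\phi:\mathbb{R}^{n_x}\times\mathbb{R}^{n_\theta}\to\mathbb{R}$ are the parameterized running and terminal costs. The Lagrangian is $$\mathcal{L}(\boldsymbol{z},\theta)=\sum_{k=0}^{N-1}\Big(\ell(x_k,u_k,\theta)+\lambda_{k+1}^\top\big(f(x_k,u_k,\theta)-x_{k+1}\big)\Big)+\lambda_0^\top(\xi(\theta)-x_0)+\phi(x_N,\theta),$$ where $\lambda_k\in\mathbb{R}^{n_x}$, $k=0,\dots,N$, are the Lagrange multipliers for the dynamics and initial condition constraints, and $\boldsymbol{z}=(\boldsymbol{\tau},\boldsymbol{\lambda})=(\lambda_0,x_0,u_0,\dots,\lambda_N,x_N)$.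 $\mathcal{L}_{\boldsymbol{z}\boldsymbol{z}}$ denotes the Hessian of $\mathcal{L}$ in $\boldsymbol{z}$, and $\mathcal{L}_{\boldsymbol{z}\theta}=\frac{\partial}{\partial\theta}\nabla_{\boldsymbol{z}}\mathcal{L}$ the matrix of mixed second partial derivatives. The implicit function theorem referred to is: let $F:\mathbb{R}^{n_z}\times\mathbb{R}^{n_\theta}\to\mathbb{R}^{n_z}$ be continuously differentiable and fix $(z_0,\theta_0)$ with $F(z_0,\theta_0)=0$. If the Jacobian $\frac{\partial F}{\partial z}(z_0,\theta_0)$ is invertible, then there exists a function $z^*(\cdot)$ defined in a neighborhood of $\theta_0$ such that $z^*(\theta_0)=z_0$ and $\frac{\partial}{\partial\theta}z^*(\theta)=-\big(\frac{\partial}{\partial z}F(z^*(\theta),\theta)\big)^{-1}\frac{\partial}{\partial\theta}F(z^*(\theta),\theta)$.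
   Formalization: The formal theorem adds the hypotheses of the quoted implicit function theorem, which optimality alone does not give: L is differentiable in z, its gradient in z is continuously differentiable in (z, θ), and L_zz is invertible at (z*, θ). *)

(* Defs.v *)
From HB Require Import structures.
From mathcomp Require Import all_boot all_order all_algebra.
From mathcomp Require Import all_classical all_reals all_analysis.

Set Implicit Arguments.
Unset Strict Implicit.
Unset Printing Implicit Defensive.

Import Order.TTheory GRing.Theory Num.Theory.
Import numFieldNormedType.Exports.

Local Open Scope classical_set_scope.
Local Open Scope ring_scope.

(* Vectors of R^n are rows, 'rV[R]_n, because the library's [jacobian] is
   stated for maps between row vectors.  That Jacobian acts on the right of
   rows, so its (i, j) entry is the i-th partial derivative of the j-th
   component; [jac] transposes it into the usual column convention. *)
Definition jac (R : realType) n m (g : 'rV[R]_n -> 'rV[R]_m) (p : 'rV[R]_n) :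
  'M[R]_(m, n) := (jacobian g p)^T.

Definition grad (R : realType) n (g : 'rV[R]_n -> R) (p : 'rV[R]_n) :
  'rV[R]_n := \row_i 'D_(delta_mx 0 i) g p.

(* All uses are in finite dimension, where continuity of p |-> 'd g p for the
   operator norm is the same as continuity of every p |-> 'd g p v. *)
Definition continuously_differentiable (R : realType) (V W : normedModType R)
    (g : V -> W) : Prop :=
  (forall p, differentiable g p) /\ (forall v, continuous (fun p => 'd g p v)).

Definition dot (R : realType) n (v w : 'rV[R]_n) : R := (v *m w^T) 0 0.

(* The indices k and k+1 among 0, ..., N, for a stage k < N. *)
Definition cur N (k : 'I_N) : 'I_N.+1 := widen_ord (leqnSn N) k.
Definition nxt N (k : 'I_N) : 'I_N.+1 := lift ord0 k.

Record ocp (R : realType) (nx nu nt : nat) := Ocp {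
  runcost : 'rV[R]_nx * 'rV[R]_nu * 'rV[R]_nt -> R ;
  termcost : 'rV[R]_nx * 'rV[R]_nt -> R ;
  dyn : 'rV[R]_nx * 'rV[R]_nu * 'rV[R]_nt -> 'rV[R]_nx ;
  init : 'rV[R]_nt -> 'rV[R]_nx }.

Section OptimalControl.
Variables (R : realType) (nx nu nt : nat) (P : ocp R nx nu nt) (N : nat).

Implicit Types (x lam : 'I_N.+1 -> 'rV[R]_nx) (u : 'I_N -> 'rV[R]_nu).
Implicit Types th : 'rV[R]_nt.

Definition cost x u th : R :=
  \sum_(k < N) runcost P (x (cur k), u k, th) + termcost P (x ord_max, th).

Definition feasible x u th : Prop :=
  (forall k : 'I_N, x (nxt k) = dyn P (x (cur k), u k, th)) /\
  x ord0 = init P th.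

Definition solution x u th : Prop :=
  feasible x u th /\
  (forall x' u', feasible x' u' th -> cost x u th <= cost x' u' th).

(* z = (lam_0, x_0, u_0, ..., lam_(N-1), x_(N-1), u_(N-1), lam_N, x_N):
   N stages of length nx + (nx + nu), followed by the final pair. *)
Definition nz : nat := (N * (nx + (nx + nu)) + (nx + nx))%N.

Definition pack x u lam : 'rV[R]_nz :=
  row_mx
    (mxvec (\matrix_(k < N) row_mx (lam (cur k)) (row_mx (x (cur k)) (u k))))
    (row_mx (lam ord_max) (x ord_max)).

Definition stage (z : 'rV[R]_nz) (k : 'I_N) : 'rV[R]_(nx + (nx + nu)) :=
  row k (vec_mx (lsubmx z)).

(* [unlift ord_max k] is [Some j] with [cur j = k] when k < N, else [None]. *)
Definition multiplier (z : 'rV[R]_nz) (k : 'I_N.+1) : 'rV[R]_nx :=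
  if unlift ord_max k is Some j then lsubmx (stage z j)
  else lsubmx (rsubmx z).

Definition state (z : 'rV[R]_nz) (k : 'I_N.+1) : 'rV[R]_nx :=
  if unlift ord_max k is Some j then lsubmx (rsubmx (stage z j))
  else rsubmx (rsubmx z).

Definition control (z : 'rV[R]_nz) (k : 'I_N) : 'rV[R]_nu :=
  rsubmx (rsubmx (stage z k)).

Lemma cur_lift_max (k : 'I_N) : cur k = lift ord_max k.
Proof. by apply: val_inj; rewrite /= /bump leqNgt ltn_ord. Qed.

Lemma stage_pack x u lam k :
  stage (pack x u lam) k = row_mx (lam (cur k)) (row_mx (x (cur k)) (u k)).
Proof. by rewrite /stage /pack row_mxKl mxvecK rowK. Qed.

Lemma multiplier_pack x u lam : multiplier (pack x u lam) = lam.
Proof.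
apply/funext => k; rewrite /multiplier; case: unliftP => [j ->|->].
  by rewrite stage_pack row_mxKl cur_lift_max.
by rewrite /pack row_mxKr row_mxKl.
Qed.

Lemma state_pack x u lam : state (pack x u lam) = x.
Proof.
apply/funext => k; rewrite /state; case: unliftP => [j ->|->].
  by rewrite stage_pack row_mxKr row_mxKl cur_lift_max.
by rewrite /pack !row_mxKr.
Qed.

Lemma control_pack x u lam : control (pack x u lam) = u.
Proof.
by apply/funext => k; rewrite /control stage_pack !row_mxKr.
Qed.

Lemma unpackK (z : 'rV[R]_nz) : pack (state z) (control z) (multiplier z) = z.
Proof.
rewrite /pack /state /multiplier unlift_none.
rewrite -[RHS]hsubmxK -[rsubmx z in RHS]hsubmxK; congr row_mx.
rewrite -[RHS]vec_mxK; congr mxvec; apply/row_matrixP => k.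
by rewrite rowK cur_lift_max liftK /control !hsubmxK.
Qed.

Definition lagrangian (z : 'rV[R]_nz) th : R :=
  let x := state z in let u := control z in let lam := multiplier z in
  \sum_(k < N) (runcost P (x (cur k), u k, th)
     + dot (lam (nxt k)) (dyn P (x (cur k), u k, th) - x (nxt k)))
  + dot (lam ord0) (init P th - x ord0)
  + termcost P (x ord_max, th).

Definition gradL (z : 'rV[R]_nz) th : 'rV[R]_nz :=
  grad (fun z' => lagrangian z' th) z.

Definition L_zz (z : 'rV[R]_nz) th : 'M[R]_nz :=
  jac (fun z' => gradL z' th) z.

Definition L_ztheta (z : 'rV[R]_nz) th : 'M[R]_(nz, nt) :=
  jac (fun th' => gradL z th') th.

End OptimalControl.

(* Main.v *)
Require Import Defs.
From HB Require Import structures.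
From mathcomp Require Import all_boot all_order all_algebra.
From mathcomp Require Import all_classical all_reals all_analysis.
From mathcomp Require Import lra ring.

Set Implicit Arguments.
Unset Strict Implicit.
Unset Printing Implicit Defensive.

Import Order.TTheory GRing.Theory Num.Theory.
Import numFieldNormedType.Exports.

Local Open Scope classical_set_scope.
Local Open Scope ring_scope.

(** Multipliers come from sensitivities of the optimal cost to perturbations of
    the constraints.  Replace the states stored in [z] by the residuals of the
    initial condition and of the dynamics ([residuals]).  This is a change of
    coordinates, because a state trajectory is recovered from its residuals by
    solving the perturbed dynamics forward ([rollout], [rollout_residuals]); the
    constraints are therefore regular at every trajectory.  In the new
    coordinates the cost becomes a value function of a perturbation of the
    constraints and of the controls.  At a solution the perturbation is zero and
    every control is admissible, so the derivative of the value function along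
    the controls vanishes by minimality; its derivative along the perturbation
    need not vanish, and minus that derivative is the multiplier.  For this
    choice, value function plus multipliers times perturbation is critical, and
    pulling it back through [residuals] gives the Lagrangian with its
    multipliers held fixed.  The remaining partial derivatives of the
    Lagrangian, along the multipliers, are the residuals themselves and vanish
    by feasibility ([multipliers_exist]).

    The differentiability of residuals, cost and dynamics that this uses is
    inherited from the Lagrangian: each entry of a residual is the increment of
    the Lagrangian when one multiplier entry moves by one, and the cost is the
    Lagrangian at zero multipliers ([differentiable_defect],
    [differentiable_cost], [differentiable_dyn]).

    The solution map is given by the implicit function theorem for the gradient
    of the Lagrangian ([implicit_function]).  With [A] the inverse of the partial
    Jacobian at the base point, the simplified Newton map
    [z |-> z - F (z, t) A] is a 1/2-contraction near the base point, by
    continuity of the Jacobian and the mean value inequality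
    ([jacobian_near], [implicit_contraction]), and its fixed points are the
    zeros of [F (_, t)].  The same estimate bounds the distance of any nearby
    [z] to the zero by twice the size of [F (z, t) A]; this gives uniqueness and
    continuity of the solution map.  A continuous solution map is differentiable
    wherever the partial Jacobian is invertible, its derivative being read off
    the first-order expansion of [F] ([implicit_is_diff]). *)

(** * Differential calculus between row vectors *)

Lemma rV_linear_differentiable (R : realType) n (V : normedModType R)
    (f : {linear 'rV[R]_n -> V}) (x : 'rV[R]_n) : differentiable f x.
Proof.
have -> : (f : 'rV[R]_n -> V) =
    \sum_(i < n) (fun v : 'rV[R]_n => v 0 i *: f (delta_mx 0 i)).
  apply/funext => v; rewrite fct_sumE [in LHS](row_sum_delta v) linear_sum /=.
  by apply: eq_bigr => i _; rewrite linearZ.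
apply: differentiable_sum => i.
exact/differentiableZl/differentiable_coord.
Qed.

Lemma rV_linear_continuous (R : realType) n (V : normedModType R)
    (f : {linear 'rV[R]_n -> V}) : continuous f.
Proof.
by move=> x; apply: differentiable_continuous; exact: rV_linear_differentiable.
Qed.

Lemma rV_linear_is_diff (R : realType) n (V : normedModType R)
    (f : 'rV[R]_n -> V) (x : 'rV[R]_n) : linear f -> is_diff x f f.
Proof.
move=> lf; pose fM := GRing.isLinear.Build _ _ _ _ _ lf.
pose fL : {linear 'rV[R]_n -> V} := HB.pack f fM.
apply: DiffDef; first exact: (rV_linear_differentiable fL).
by rewrite (diff_lin (f := fL))//; exact: rV_linear_continuous.
Qed.

Lemma differentiable_rV (R : realType) n (V : normedModType R)
    (f : V -> 'rV[R]_n) (x : V) :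
  (forall i, differentiable (fun y => f y 0 i) x) -> differentiable f x.
Proof.
move=> df.
have -> : f = \sum_(i < n) (fun y => f y 0 i *: delta_mx 0 i).
  by apply/funext => y; rewrite fct_sumE -row_sum_delta.
by apply: differentiable_sum => i; exact: differentiableZl.
Qed.

Lemma rV_norm_le (R : realType) n (v : 'rV[R]_n) (M : R) :
  0 <= M -> (forall j, `|v 0 j| <= M) -> `|v| <= M.
Proof.
move=> M0 vM; rewrite [leLHS]/Num.Def.normr/= mx_normrE.
by apply: bigmax_le => // -[i j] _ /=; rewrite ord1.
Qed.

Lemma coord_le_norm (R : realType) n (v : 'rV[R]_n) j : `|v 0 j| <= `|v|.
Proof.
rewrite [leRHS]/Num.Def.normr/= mx_normrE.
exact: (le_bigmax _ (fun i : 'I_1 * 'I_n => `|v i.1 i.2|) (0, j)).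
Qed.

Lemma mulmx_norm_le (R : realType) n m (v : 'rV[R]_n) (M : 'M[R]_(n, m))
    (e : R) :
  0 <= e -> (forall i j, `|M i j| <= e) -> `|v *m M| <= n%:R * e * `|v|.
Proof.
move=> e0 Me; apply: rV_norm_le => [|j]; first by rewrite !mulr_ge0.
rewrite mxE (le_trans (ler_norm_sum _ _ _))//.
rewrite -mulrA -[n in n%:R]card_ord mulr_natl -sumr_const.
apply: ler_sum => i _; rewrite normrM mulrC ler_pM//.
exact: coord_le_norm.
Qed.

Lemma is_diff_line (R : realType) (V W : normedModType R) (f : V -> W)
    (a w : V) (s : R) : differentiable f (a + s *: w) ->
  is_diff s (fun r : R => f (a + r *: w)) (fun h => 'd f (a + s *: w) (h *: w)).
Proof.
move=> df.
have dl : is_diff s (fun r : R => a + r *: w) (fun h => h *: w).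
  have := is_diffD (is_diff_cst a s) (is_diff_scalel s w).
  by rewrite add0r.
have dfl : is_diff (a + s *: w) f ('d f (a + s *: w)) by exact: differentiableP.
exact: (is_diff_comp dl dfl).
Qed.

(** The norm is the maximum of the absolute values of the coordinates, so the
    one-dimensional mean value theorem on each coordinate suffices, although the
    intermediate points differ. *)
Lemma mean_value_le (R : realType) (V : normedModType R) m (f : V -> 'rV[R]_m)
    (a b : V) (M : R) :
  (forall s : R, 0 <= s <= 1 -> differentiable f (a + s *: (b - a))) ->
  (forall s : R, 0 <= s <= 1 -> `|'d f (a + s *: (b - a)) (b - a)| <= M) ->
  `|f b - f a| <= M.
Proof.
move=> df dM; apply: rV_norm_le => [|j].
  by rewrite (le_trans (normr_ge0 _) (dM 0 _))// lexx ler01.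
pose g (s : R) : R := f (a + s *: (b - a)) 0 j.
have dg (s : R) : 0 <= s <= 1 ->
    is_diff s g (fun h => 'd f (a + s *: (b - a)) (h *: (b - a)) 0 j).
  move=> /df /is_diff_line dfs.
  have dc : is_diff (f (a + s *: (b - a)))
      (fun v : 'rV[R]_m => v 0 j) (fun v => v 0 j).
    by apply: rV_linear_is_diff => k u v; rewrite !mxE.
  exact: (is_diff_comp dfs dc).
have [c c01] : exists2 c, c \in `[0, 1] &
    g 1 - g 0 = 'd f (a + c *: (b - a)) (b - a) 0 j * (1 - 0).
  apply: MVT_segment => // [s|].
    rewrite in_itv/= => /andP[/ltW s0 /ltW s1].
    have /dg dgs : 0 <= s <= 1 by rewrite s0 s1.
    apply: DeriveDef; first by apply/derivable1_diffP; exact: ex_diff.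
    by rewrite deriveE ?diff_val ?scale1r//; exact: ex_diff.
  apply: continuous_in_subspaceT => s; rewrite inE/= in_itv/= => /dg dgs.
  by apply: differentiable_continuous; exact: ex_diff.
rewrite subr0 mulr1 /g scale0r addr0 scale1r subrKC => gE.
by rewrite !mxE gE (le_trans (coord_le_norm _ _))// dM.
Qed.

Lemma jacobian_val (R : realType) n m (f : 'rV[R]_n -> 'rV[R]_m) (x : 'rV[R]_n)
  (M : 'M[R]_(n, m)) : is_diff x f (mulmxr M) -> jacobian f x = M.
Proof.
move=> df; apply/row_matrixP => i.
by rewrite !rowE mul_rV_lin1 diff_val.
Qed.

Lemma eq_differentiable (R : realType) (V W : normedModType R) (f g : V -> W)
    (x : V) :
  f =1 g -> differentiable f x -> differentiable g x.
Proof. by move=> /funext ->. Qed.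

(** A directional derivative sees a function only along one line; the base
    points may differ, which allows changing the coordinates that the function
    ignores. *)
Lemma derive_eq_line (R : realType) (V W : normedModType R) (f g : V -> W)
    (a b w : V) :
  (forall t : R, f (t *: w + a) = g (t *: w + b)) -> 'D_w f a = 'D_w g b.
Proof.
move=> fg; have fgab : f a = g b by have := fg 0; rewrite scale0r !add0r.
rewrite /derive (_ : (fun h : R => _) =
  (fun h : R => h^-1 *: ((g \o shift b) (h *: w) - g b)))//.
by apply/funext => t /=; rewrite fg fgab.
Qed.

Lemma diff_eq0_at_min (R : realType) (V : normedModType R) (f : V -> R)
    (a w : V) :
  (forall b, differentiable f b) ->
  (forall t : R, f a <= f (a + t *: w)) -> 'd f a w = 0.
Proof.
move=> df fmin.
pose g (t : R) : R := f (a + t *: w).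
have dg t : is_diff t g (fun h => 'd f (a + t *: w) (h *: w)).
  exact: is_diff_line.
have g0 : is_derive (0 : R) 1 g 0.
  apply: (@derive1_at_min _ g (-1) 1) => [|t _||t _].
  - lra.
  - by apply/derivable1_diffP; exact: (ex_diff (is_diff_def := dg t)).
  - by rewrite in_itv /=; apply/andP; split; lra.
  - by rewrite /g scale0r addr0.
have := @derive_val _ _ _ _ _ _ _ g0.
rewrite deriveE; last exact: (ex_diff (is_diff_def := dg 0)).
by rewrite (diff_val (is_diff_def := dg 0)) scale0r addr0 scale1r.
Qed.

Lemma dominated_continuous (R : realType) (U V W : normedModType R)
    (f : U -> V) (g : U -> W) (k : R) (x : U) :
  0 < k -> {for x, continuous g} -> g x = 0 ->
  (\forall y \near x, `|f x - f y| <= k * `|g y|) -> {for x, continuous f}.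
Proof.
move=> k0 cg gx fg; apply/cvgrPdist_le => e e0.
have ek : 0 < e / k by rewrite divr_gt0.
have /cvgrPdist_le/(_ _ ek) := cg.
rewrite gx => /(filterI fg); apply: filterS => y [/= fy].
rewrite sub0r normrN => gy; apply: (le_trans fy).
by rewrite mulrC -ler_pdivlMr.
Qed.

(** A row vector in the kernel of [M] would be shrunk by a factor [k < 1] while
    being left unchanged. *)
Lemma unitmx_contraction (R : realType) n (M : 'M[R]_n) (k : R) : k < 1 ->
  (forall w : 'rV[R]_n, `|w - w *m M| <= k * `|w|) -> M \in unitmx.
Proof.
move=> k1 Mk; rewrite -row_free_unit -kermx_eq0; apply/eqP/row_matrixP => i.
rewrite row0; set w := row i _.
have wM : w *m M = 0 by apply/sub_kermxP; exact: row_sub.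
have := Mk w; rewrite wM subr0 => wk.
apply/eqP; rewrite -normr_le0; have := normr_ge0 w; nra.
Qed.

Lemma dot0r (R : realType) n (v : 'rV[R]_n) : dot v 0 = 0.
Proof. by rewrite /dot trmx0 mulmx0 mxE. Qed.

Lemma dot_linear (R : realType) n (v : 'rV[R]_n) :
  linear (dot v : 'rV[R]_n -> R).
Proof. by move=> c w w'; rewrite /dot linearP mulmxDr -scalemxAr !mxE. Qed.

Lemma dot_delta (R : realType) n (w : 'rV[R]_n) i :
  dot (delta_mx 0 i) w = w 0 i.
Proof. by rewrite /dot -rowE !mxE. Qed.

(** * The implicit function theorem *)

Section ImplicitFunction.
Variables (R : realType) (n m : nat) (F : 'rV[R]_n * 'rV[R]_m -> 'rV[R]_n).

Let D1 (p : 'rV[R]_n * 'rV[R]_m) : 'M[R]_n :=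
  jacobian (fun z => F (z, p.2)) p.1.
Let D2 (p : 'rV[R]_n * 'rV[R]_m) : 'M[R]_(m, n) :=
  jacobian (fun t => F (p.1, t)) p.2.

Lemma is_diff_left (p : 'rV[R]_n * 'rV[R]_m) : differentiable F p ->
  is_diff (p.1) (fun z => F (z, p.2)) (fun w => 'd F p (w, 0)).
Proof.
case: p => z t /differentiableP dF /=.
have dp := is_diff_pair (is_diff_id z) (is_diff_cst t z).
exact: (is_diff_comp dp dF).
Qed.

Lemma is_diff_right (p : 'rV[R]_n * 'rV[R]_m) : differentiable F p ->
  is_diff (p.2) (fun t => F (p.1, t)) (fun h => 'd F p (0, h)).
Proof.
case: p => z t /differentiableP dF /=.
have dp := is_diff_pair (is_diff_cst z t) (is_diff_id t).
exact: (is_diff_comp dp dF).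
Qed.

Lemma diff_jacobian (p : 'rV[R]_n * 'rV[R]_m) w h : differentiable F p ->
  'd F p (w, h) = w *m D1 p + h *m D2 p.
Proof.
move=> dF; have d1 := is_diff_left dF; have d2 := is_diff_right dF.
rewrite !mul_rV_lin1 /= !diff_val -linearD /=.
by congr ('d F p _); congr pair; rewrite /= ?addr0 ?add0r.
Qed.

(** Write [dz] for the increment of [zs] over [h] and [dL] for the expected
    derivative.  Continuity of [zs] makes the expansion of [F] at [(zs t, t)]
    applicable, but it only gives [dz - dL h = o(dz, h)], in which the unknown
    increment occurs on both sides.  Absorbing half of [|dz|] on the left shows
    that [dz = O(h)], hence that the error is [o(h)]. *)
Lemma implicit_is_diff (zs : 'rV[R]_m -> 'rV[R]_n) t :
  differentiable F (zs t, t) -> D1 (zs t, t) \in unitmx ->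
  {for t, continuous zs} -> (\forall t' \near t, F (zs t', t') = 0) ->
  is_diff t zs (mulmxr (- (D2 (zs t, t) *m invmx (D1 (zs t, t))))).
Proof.
set p := (zs t, t); set B := invmx _ => dF uJ czs Fzs.
set L : 'M[R]_(m, n) := D2 p *m B.
pose dL : {linear 'rV[R]_m -> 'rV[R]_n} := mulmxr (- L).
have dLE h : dL h = - (h *m L) by rewrite /dL /= mulmxN.
suff H : zs \o shift t = cst (zs t) + dL +o_ (0 : 'rV[R]_m) id.
  have cL : continuous dL by exact: rV_linear_continuous.
  have dzs := diff_unique cL H.
  by apply: DiffDef => //; apply/diff_locallyP; rewrite dzs.
have [b b0 Bb] := linear_lipschitz (@rV_linear_continuous _ _ _ (mulmxr B)).
have [l l0 Ll] := linear_lipschitz (rV_linear_continuous (f := dL)).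
apply/eqaddoP => e e0; rewrite /= nearE.
(* The factor 1/2 absorbs [|dz|]; then [|dz| <= (2 l + 1) |h|], and the other
   bound turns [e' (|dz| + |h|)] into [e |h|]. *)
pose e' := Num.min (1 / 2) (e / (2 * l + 2)).
have e'0 : 0 < e' by rewrite lt_min divr_gt0// divr_gt0//; nra.
have be0 : 0 < e' / b by rewrite divr_gt0.
have [_ dFE] := (diff_locallyP _ _).1 dF.
have /eqaddoP/(_ _ be0) Fo := dFE.
have shift_t : (fun h => h + t) @ nbhs (0 : 'rV[R]_m) --> t.
  by rewrite -[X in _ --> X]add0r; apply: cvgD => //; exact: cvg_cst.
have dz0 : (fun h : 'rV[R]_m => (zs (h + t) - zs t, h)) @
    nbhs (0 : 'rV[R]_m) --> (0 : 'rV[R]_n * 'rV[R]_m).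
  have H1 : zs (h + t) - zs t @[h --> nbhs (0 : 'rV[R]_m)] --> (0 : 'rV[R]_n).
    rewrite -[X in _ --> X](subrr (zs t)); apply: cvgB; last exact: cvg_cst.
    exact: (cvg_comp _ _ shift_t czs).
  exact: (cvg_pair H1 cvg_id).
have := dz0 _ Fo; rewrite nbhs_filterE => Fo'.
have Fzs' := shift_t _ Fzs.
near=> h.
have F0 : F (zs t, t) = 0 by exact: nbhs_singleton Fzs.
have Fh : F (zs (h + t), h + t) = 0 by near: h; exact: Fzs'.
have : `|((F \o shift p) - (cst (F p) + 'd F p)) (zs (h + t) - zs t, h)|
   <= e' / b * `|(zs (h + t) - zs t, h)| by near: h; exact: Fo'.
rewrite /= !fctE /=.
have -> : (zs (h + t) - zs t, h) + p = (zs (h + t), h + t).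
  by rewrite /p; congr pair; rewrite /= ?subrK.
rewrite Fh F0 !add0r normrN diff_jacobian//.
set dz := zs (h + t) - zs t.
rewrite prod_normE /= => Hdz.
have Bbd := Bb (dz *m D1 p + h *m D2 p).
rewrite /= mulmxDl mulmxK// -mulmxA -/L -[h *m L]opprK -dLE in Bbd.
have Hl := Ll h.
rewrite [zs t + _]addrC opprD addrA -addrA [- _ - _]addrC addrA -/dz.
have tri : `|dz| <= `|dz - dL h| + `|dL h|.
  by rewrite -[leLHS](congr1 _ (subrK (dL h) dz)) ler_normD.
have mx : Num.max `|dz| `|h| <= `|dz| + `|h|.
  by rewrite ge_max lerDl lerDr !normr_ge0.
have H1 : `|dz - dL h| <= e' * (`|dz| + `|h|).
  apply: (le_trans Bbd); rewrite -ler_pdivlMl// mulrA [_^-1 * _]mulrC.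
  by apply: (le_trans Hdz); rewrite ler_pM2l.
have e'1 : e' <= 1 / 2 by rewrite ge_min lexx.
have e'2 : e' * (2 * l + 2) <= e.
  by rewrite -ler_pdivlMr ?ge_min ?lexx ?orbT//; nra.
have h0 := normr_ge0 h; have z0 := normr_ge0 dz.
have H2 : `|dz| <= (2 * l + 1) * `|h| by nra.
apply: (le_trans H1).
have : e' * (`|dz| + `|h|) <= e' * ((2 * l + 2) * `|h|).
  by rewrite ler_pM2l//; nra.
by move=> /le_trans; apply; rewrite mulrA ler_wpM2r.
Unshelve. all: by end_near. Qed.

Hypothesis FC1 : continuously_differentiable F.

(** The entries of the Jacobian at [p] are coordinates of ['d F p] at basis
    vectors, so they are continuous in [p] and the product with the inverse of
    the Jacobian at [p0] has entries close to those of the identity. *)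
Lemma jacobian_near (p0 : 'rV[R]_n * 'rV[R]_m) :
  D1 p0 \in unitmx -> exists2 r : R, 0 < r &
    forall (z : 'rV[R]_n) (t : 'rV[R]_m),
      `|z - p0.1| <= r -> `|t - p0.2| <= r ->
    forall w : 'rV[R]_n,
      `|w - w *m (D1 (z, t) *m invmx (D1 p0))| <= 1 / 2 * `|w|.
Proof.
move=> uJ; set A := invmx (D1 p0).
(* [n.+1] rather than [n] keeps the bound meaningful in dimension zero. *)
pose e : R := (2 * n.+1%:R)^-1.
have e0 : 0 < e by rewrite invr_gt0 mulr_gt0.
have cJ i j : {for p0, continuous (fun p => (D1 p *m A) i j)}.
  pose l (v : 'rV[R]_n) : R := (v *m A) 0 j.
  have -> : (fun p => (D1 p *m A) i j) =
      l \o (fun p => 'd F p (delta_mx 0 i, 0)).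
    apply/funext => p; rewrite /l/= diff_jacobian; last exact: FC1.1.
    by rewrite mul0mx addr0 -mulmxA -rowE [RHS]mxE.
  have ll : linear l by move=> c u v; rewrite /l mulmxDl -scalemxAl !mxE.
  have dl v : differentiable l v.
    exact: (ex_diff (is_diff_def := rV_linear_is_diff _ ll)).
  apply: continuous_comp; first exact: FC1.2.
  exact: (differentiable_continuous (dl _)).
have /= := @filter_forall _ _ (fun (ij : 'I_n * 'I_n) p =>
  `|(1%:M - D1 p *m A) ij.1 ij.2| <= e) (nbhs p0) (nbhs_filter p0).
case/(_ _)/nbhs_normP => [[i j]|r /= r0 rE].
  have /cvgrPdist_le/(_ _ e0) := cJ i j.
  have subE (M K : 'M[R]_n) : (M - K) i j = M i j - K i j by rewrite !mxE.
  by apply: filterS => p /=; move: (D1 p) => K; rewrite subE mulmxV.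
exists (r / 2); first by rewrite divr_gt0.
move=> z t zr tr w.
have r2 : r / 2 < r by rewrite gtr_pMr// invf_lt1// ltr1n.
have /rE E : `|p0 - (z, t)| < r.
  rewrite distrC prod_normE /= gt_max.
  by rewrite (le_lt_trans zr r2) (le_lt_trans tr r2).
rewrite -[X in `|X - _|]mulmx1 -mulmxBr.
apply: (le_trans (mulmx_norm_le _ (ltW e0) _)) => [i j|].
  exact: (E (i, j)).
rewrite ler_wpM2r// /e div1r invfM mulrCA ler_piMr ?invr_ge0//.
by rewrite ler_pdivrMr ?mul1r ?ler_nat.
Qed.

(** The mean value inequality for [z |-> z - F (z, t) A], along the segment
    joining two points of the ball. *)
Lemma implicit_contraction (A : 'M[R]_n) (z0 : 'rV[R]_n) (t : 'rV[R]_m)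
    (r k : R) :
  (forall z : 'rV[R]_n, `|z - z0| <= r ->
     forall w : 'rV[R]_n, `|w - w *m (D1 (z, t) *m A)| <= k * `|w|) ->
  forall z z' : 'rV[R]_n, `|z - z0| <= r -> `|z' - z0| <= r ->
    `|(z - z') - (F (z, t) - F (z', t)) *m A| <= k * `|z - z'|.
Proof.
move=> JA z z' zr z'r.
pose T (y : 'rV[R]_n) := y - F (y, t) *m A.
have dT y : is_diff y T (fun w => w - w *m (D1 (y, t) *m A)).
  have dl : is_diff y (fun y => F (y, t)) (fun w => w *m D1 (y, t)).
    have dF : differentiable F (y, t) by exact: FC1.1.
    have -> : (fun w => w *m D1 (y, t)) = (fun w => 'd F (y, t) (w, 0)).
      by apply/funext => w; rewrite diff_jacobian// mul0mx addr0.
    exact: (is_diff_left dF).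
  have dA : is_diff (F (y, t)) (mulmxr A) (mulmxr A).
    by apply: rV_linear_is_diff => c u v; rewrite linearP.
  have := is_diffB (is_diff_id y) (is_diff_comp dl dA).
  congr is_diff_def; apply/funext => w.
  by rewrite !fctE /= mulmxA.
have -> : (z - z') - (F (z, t) - F (z', t)) *m A = T z - T z'.
  by rewrite /T mulmxBl opprD addrACA -opprD.
apply: mean_value_le => s /andP[s0 s1].
  exact: (ex_diff (is_diff_def := dT _)).
rewrite (diff_val (is_diff_def := dT _)); apply: JA.
have -> : z' + s *: (z - z') - z0 = (1 - s) *: (z' - z0) + s *: (z - z0).
  by apply/rowP => i; rewrite !mxE; ring.
rewrite (le_trans (ler_normD _ _))// !normrZ !ger0_norm ?subr_ge0//.
nra.
Qed.

(** Banach's fixed point theorem for [z |-> z - F (z, t) A] on the closed ball: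
    the centre moves by at most [r / 2] and distances are halved, so the ball is
    mapped into itself. *)
Lemma implicit_exists (A : 'M[R]_n) (z0 : 'rV[R]_n) (t : 'rV[R]_m) (r : R) :
  A \in unitmx -> 0 <= r ->
  (forall z z' : 'rV[R]_n, `|z - z0| <= r -> `|z' - z0| <= r ->
    `|(z - z') - (F (z, t) - F (z', t)) *m A| <= 1 / 2 * `|z - z'|) ->
  `|F (z0, t) *m A| <= r / 2 ->
  exists z, `|z - z0| <= r /\ F (z, t) = 0.
Proof.
move=> uA r0 ctr F0.
pose T (y : 'rV[R]_n) := y - F (y, t) *m A.
have TB z z' : T z - T z' = (z - z') - (F (z, t) - F (z', t)) *m A.
  by rewrite /T mulmxBl [in RHS]opprD [in RHS]addrACA -opprD.
pose Z : completeNormedModType R := HB.pack 'rV[R]_n.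
pose U : set Z := closed_ball_ Num.norm z0 r.
have UE z : U z = (`|z - z0| <= r) by rewrite /U /closed_ball_ /= distrC.
have TU : {homo T : z / U z}.
  move=> z; rewrite !UE => zr.
  have Tz0 : T z0 + F (z0, t) *m A = z0 by rewrite /T subrK.
  have -> : T z - z0 = (T z - T z0) - F (z0, t) *m A.
    by rewrite -[in LHS]Tz0 opprD addrA.
  rewrite (le_trans (ler_normB _ _))// TB.
  have := ctr z z0 zr; rewrite subrr normr0 => /(_ r0).
  lra.
pose fT : {fun U >-> U} := HB.pack (T : Z -> Z) (isFun.Build _ _ U U T TU).
have [z Uz zT] : exists2 p, U p & p = fT p.
  apply: banach_fixed_point.
  - exists ((1 / 2 : R)%:nng); split => /=; first lra.
    by move=> [z z'] [] /=; rewrite !UE => zr z'r; rewrite TB ctr.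
  - exact: closed_closed_ball_.
  - by exists z0; rewrite UE subrr normr0.
exists z; split; first by rewrite -UE.
have : F (z, t) *m A = 0.
  apply/eqP; rewrite -oppr_eq0 -(inj_eq (addrI (z : 'rV[R]_n))) addr0.
  by rewrite [eqbRHS]zT.
by move=> /(congr1 (mulmx^~ (invmx A))); rewrite mulmxK// mul0mx.
Qed.

(** For each [t] near [t0], [zs t] is the zero of [F (_, t)] in a fixed ball
    around [z0].  The contraction estimate holds on the whole ball, not only at
    the base point, so invertibility of the Jacobian, continuity and
    differentiability follow at every such [t]. *)
Theorem implicit_function (z0 : 'rV[R]_n) (t0 : 'rV[R]_m) :
  F (z0, t0) = 0 -> D1 (z0, t0) \in unitmx ->
  exists zs : 'rV[R]_m -> 'rV[R]_n, zs t0 = z0 /\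
    \forall t \near t0, [/\ F (zs t, t) = 0, D1 (zs t, t) \in unitmx &
      is_diff t zs (mulmxr (- (D2 (zs t, t) *m invmx (D1 (zs t, t)))))].
Proof.
move=> F0 uJ; pose A := invmx (D1 (z0, t0)).
have uA : A \in unitmx by rewrite unitmx_inv.
have [r r0 JA] := jacobian_near uJ.
rewrite /= -[invmx _]/A in JA.
pose good t := `|t - t0| <= r /\ `|F (z0, t) *m A| <= r / 2.
have ctr t : `|t - t0| <= r -> forall z z' : 'rV[R]_n,
    `|z - z0| <= r -> `|z' - z0| <= r ->
    `|(z - z') - (F (z, t) - F (z', t)) *m A| <= 1 / 2 * `|z - z'|.
  by move=> tr; apply: implicit_contraction => z zr w; exact: JA.
have cF z t : {for t, continuous (fun t => F (z, t) *m A)}.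
  have dF : differentiable F (z, t) by exact: FC1.1.
  have dA : differentiable (mulmxr A) (F (z, t)).
    exact: rV_linear_differentiable.
  have dR := ex_diff (is_diff_def := is_diff_right dF).
  exact: (differentiable_continuous (differentiable_comp dR dA)).
have r20 : 0 < r / 2 by rewrite divr_gt0.
have good0 : \forall t \near t0, good t.
  have g1 : \forall t \near t0, `|t - t0| <= r.
    by apply/nbhs_normP; exists r => //= t /=; rewrite distrC => /ltW.
  have g2 : \forall t \near t0, `|F (z0, t) *m A| <= r / 2.
    have /cvgrPdist_le/(_ _ r20) := cF z0 t0.
    by apply: filterS => t; rewrite F0 mul0mx sub0r normrN.
  exact: filterI g1 g2.
pose sol t (z : 'rV[R]_n) := `|z - z0| <= r /\ F (z, t) = 0.
pose zs t := xget z0 (sol t).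
have zsP t : good t -> sol t (zs t).
  move=> [tr Ft]; apply: xgetPex.
  exact: (implicit_exists uA (ltW r0) (ctr _ tr) Ft).
(* Any approximate zero is close to the zero; this yields both uniqueness and
   continuity of [zs]. *)
have zs_dist t z : good t -> `|z - z0| <= r ->
    `|z - zs t| <= 2 * `|F (z, t) *m A|.
  move=> gt zr; have [zsr Fzs] := zsP _ gt.
  have := ctr _ gt.1 _ _ zr zsr; rewrite Fzs subr0.
  set a := z - zs t; set b := F (z, t) *m A => ab.
  have := ler_normD (a - b) b; rewrite subrK.
  lra.
exists zs; split.
  have := zs_dist t0 z0 (nbhs_singleton good0).
  rewrite subrr normr0 F0 mul0mx normr0 mulr0 => /(_ (ltW r0)).
  by rewrite normr_le0 subr_eq0 => /eqP.
have := nbhs_interior good0; apply: filterS => t gt.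
have gt' := nbhs_singleton gt.
have [zsr Fzs] := zsP _ gt'.
have uD : D1 (zs t, t) \in unitmx.
  have : D1 (zs t, t) *m A \in unitmx.
    apply: (@unitmx_contraction _ _ _ (1 / 2)) => [|w]; first lra.
    exact: JA zsr gt'.1 w.
  by rewrite unitmx_mul => /andP[].
have czs : {for t, continuous zs}.
  apply: (dominated_continuous (ltr0Sn _ 1) (cF (zs t) t)).
    by rewrite Fzs mul0mx.
  by apply: filterS gt => t' gt''; exact: zs_dist.
split=> //; apply: implicit_is_diff => //; first exact: FC1.1.
by apply: (filterS _ gt) => t' /zsP[].
Qed.

End ImplicitFunction.

(** * Coordinates of trajectories and multipliers *)

Section Optimality.
Variables (R : realType) (nx nu nt N : nat) (P : ocp R nx nu nt).
Variable th : 'rV[R]_nt.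

Local Notation Z := 'rV[R]_(nz nx nu N).

Lemma unpack_inj (z z' : Z) : state z = state z' -> control z = control z' ->
  multiplier z = multiplier z' -> z = z'.
Proof. by move=> sz cz mz; rewrite -(unpackK z) sz cz mz unpackK. Qed.

Lemma stage_linear k : linear (fun z : Z => stage z k).
Proof. by move=> c z z'; rewrite /stage !linearP. Qed.

Lemma state_linear k : linear (fun z : Z => state z k).
Proof.
move=> c z z'; rewrite /state.
by case: unliftP => [j _|_]; rewrite ?stage_linear !linearP.
Qed.

Lemma multiplier_linear k : linear (fun z : Z => multiplier z k).
Proof.
move=> c z z'; rewrite /multiplier.
by case: unliftP => [j _|_]; rewrite ?stage_linear !linearP.
Qed.

Lemma control_linear k : linear (fun z : Z => control z k).
Proof. by move=> c z z'; rewrite /control stage_linear !linearP. Qed.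

Lemma pack_linear (c : R) x x' u u' lam lam' :
  pack (fun k => c *: x k + x' k) (fun k => c *: u k + u' k)
    (fun k => c *: lam k + lam' k) = c *: pack x u lam + pack x' u' lam' :> Z.
Proof.
by apply: unpack_inj; apply/funext => k;
  rewrite ?state_linear ?control_linear ?multiplier_linear;
  rewrite ?state_pack ?control_pack ?multiplier_pack.
Qed.

Lemma pack_sum_states (s : 'I_N.+1 -> 'rV[R]_nx) :
  pack s (fun=> 0) (fun=> 0) =
  \sum_k pack (fun j => if j == k then s k else 0) (fun=> 0) (fun=> 0) :> Z.
Proof.
have lin0 (V : lmodType R) (f : Z -> V) : linear f -> forall (F : 'I_N.+1 -> Z),
    f (\sum_k F k) = \sum_k f (F k).
  move=> lf; pose fM := GRing.isLinear.Build _ _ _ _ _ lf.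
  pose fL : {linear Z -> V} := HB.pack f fM.
  exact: (linear_sum fL).
apply: unpack_inj; apply/funext => j.
- rewrite (lin0 _ _ (state_linear j)) state_pack (bigD1 j)//= state_pack eqxx.
  rewrite big1 ?addr0// => k /negPf kj.
  by rewrite state_pack eq_sym kj.
- rewrite (lin0 _ _ (control_linear j)) control_pack big1// => k _.
  by rewrite control_pack.
- rewrite (lin0 _ _ (multiplier_linear j)) multiplier_pack big1// => k _.
  by rewrite multiplier_pack.
Qed.

Lemma differentiable_pack (V : normedModType R)
    (x lam : V -> 'I_N.+1 -> 'rV[R]_nx) (u : V -> 'I_N -> 'rV[R]_nu) (v : V) :
  (forall k, differentiable (x ^~ k) v) ->
  (forall k, differentiable (u ^~ k) v) ->
  (forall k, differentiable (lam ^~ k) v) ->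
  differentiable (fun v => pack (x v) (u v) (lam v)) v.
Proof.
move=> dx du dl.
have dcoord n (f : V -> 'rV[R]_n) j :
    differentiable f v -> differentiable (fun v => f v 0 j : R) v.
  by move=> df; exact: (differentiable_comp df (differentiable_coord _ _ _)).
apply: differentiable_rV => i.
case: (split_ordP i) => [{}i ->|{}i ->]; rewrite /pack.
  under eq_fun do rewrite row_mxEl.
  case/mxvec_indexP: i => k i.
  under eq_fun do rewrite mxvecE mxE.
  case: (split_ordP i) => [{}i ->|{}i ->];
    under eq_fun do rewrite ?row_mxEl ?row_mxEr.
    exact: dcoord.
  case: (split_ordP i) => [{}i ->|{}i ->];
    under eq_fun do rewrite ?row_mxEl ?row_mxEr.
    exact: dcoord.
  exact: dcoord.
under eq_fun do rewrite row_mxEr.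
case: (split_ordP i) => [{}i ->|{}i ->].
  under eq_fun do rewrite row_mxEl.
  exact: (dcoord _ (lam ^~ ord_max)).
under eq_fun do rewrite row_mxEr.
exact: (dcoord _ (x ^~ ord_max)).
Qed.

(** * The Lagrangian and the constraint residuals *)

(** Indexed like the multipliers: 0 for the initial condition, [k + 1] for the
    dynamics of stage [k]. *)
Definition defect (z : Z) (k : 'I_N.+1) : 'rV[R]_nx :=
  if unlift ord0 k is Some j
  then dyn P (state z (cur j), control z j, th) - state z (nxt j)
  else init P th - state z ord0.

Lemma lagrangianE (z : Z) : lagrangian P z th =
  cost P (state z) (control z) th + \sum_k dot (multiplier z k) (defect z k).
Proof.
rewrite /lagrangian /cost big_ord_recl {1}/defect unlift_none big_split /=.
have -> : \sum_(k < N)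
    dot (multiplier z (lift ord0 k)) (defect z (lift ord0 k)) =
  \sum_(k < N) dot (multiplier z (nxt k))
     (dyn P (state z (cur k), control z k, th) - state z (nxt k)).
  by apply: eq_bigr => k _; rewrite /defect liftK.
by rewrite -!addrA; congr (_ + _); rewrite [RHS]addrC [RHS]addrAC [RHS]addrC.
Qed.

Hypothesis L_diff :
  forall z : Z, differentiable (fun z' => lagrangian P z' th) z.

Lemma differentiable_state z k :
  differentiable (fun z : Z => state z k) z.
Proof.
exact: (ex_diff (is_diff_def := rV_linear_is_diff _ (state_linear k))).
Qed.

Lemma differentiable_control z k :
  differentiable (fun z : Z => control z k) z.
Proof.
exact: (ex_diff (is_diff_def := rV_linear_is_diff _ (control_linear k))).
Qed.

Lemma differentiable_multiplier z k :
  differentiable (fun z : Z => multiplier z k) z.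
Proof.
exact: (ex_diff (is_diff_def := rV_linear_is_diff _ (multiplier_linear k))).
Qed.

(** The cost is the Lagrangian at zero multipliers. *)
Lemma differentiable_cost (V : normedModType R) (x : V -> 'I_N.+1 -> 'rV[R]_nx)
    (u : V -> 'I_N -> 'rV[R]_nu) (v : V) :
  (forall k, differentiable (x ^~ k) v) ->
  (forall k, differentiable (u ^~ k) v) ->
  differentiable (fun v => cost P (x v) (u v) th) v.
Proof.
move=> dx du.
have dp : differentiable (fun v => pack (x v) (u v) (fun=> 0)) v.
  by apply: differentiable_pack => // k; exact: differentiable_cst.
apply: eq_differentiable (differentiable_comp dp (L_diff _)) => y.
rewrite /= lagrangianE state_pack control_pack multiplier_pack.
rewrite big1 ?addr0// => k _.
by rewrite /dot mul0mx mxE.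
Qed.

(** The Lagrangian is affine in the multipliers with the residuals as slopes, so
    the [i]-th entry of residual [k] is its increment when multiplier [k] moves
    by a basis vector. *)
Lemma differentiable_defect z k : differentiable (fun z => defect z k) z.
Proof.
apply: differentiable_rV => i.
pose e := pack (fun=> 0) (fun=> 0)
  (fun j => if j == k then delta_mx 0 i else 0) : Z.
have de : differentiable (fun z : Z => e + z) z.
  by apply: differentiableD => //; exact: differentiable_cst.
apply: eq_differentiable
  (differentiableB (differentiable_comp de (L_diff _)) (L_diff z)) => y.
rewrite !fctE /= !lagrangianE.
have [sE cE] : state (e + y) = state y /\ control (e + y) = control y.
  by split; apply/funext => j; rewrite -[e]scale1r ?state_linear ?control_linear
    ?state_pack ?control_pack scaler0 add0r.
have dE : defect (e + y) = defect y by rewrite /defect sE cE.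
rewrite sE cE dE opprD addrACA subrr add0r -sumrB (bigD1 k)//= big1 ?addr0.
  rewrite -[e]scale1r multiplier_linear multiplier_pack eqxx scale1r.
  by rewrite /dot mulmxDl mxE addrK -/(dot _ _) dot_delta.
move=> j /negPf jk; rewrite -[e]scale1r multiplier_linear multiplier_pack jk.
by rewrite scaler0 add0r subrr.
Qed.

(** The dynamics is a residual plus the next state, evaluated on the constant
    trajectory; a stage [k] must exist for that residual to occur. *)
Lemma differentiable_dyn (V : normedModType R) (x : V -> 'rV[R]_nx)
    (u : V -> 'rV[R]_nu) (v : V) (k : 'I_N) :
  differentiable x v -> differentiable u v ->
  differentiable (fun v => dyn P (x v, u v, th)) v.
Proof.
move=> dx du.
have dp :
    differentiable (fun v => pack (fun=> x v) (fun=> u v) (fun=> 0) : Z) v.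
  by apply: differentiable_pack => // ?; exact: differentiable_cst.
apply: eq_differentiable (differentiableD
  (differentiable_comp dp (differentiable_defect _ (nxt k))) dx) => y.
by rewrite !fctE /= /defect liftK state_pack control_pack subrK.
Qed.

(** The state slots of [z] are read as perturbations of the constraints, not as
    states; indices beyond the horizon get the default value 0. *)
Fixpoint rollout (z : Z) (n : nat) : 'rV[R]_nx :=
  if n is n'.+1 then
    if insub n' is Some k
    then dyn P (rollout z n', control z k, th) - state z (nxt k)
    else 0
  else init P th - state z ord0.

Lemma rolloutS z (k : 'I_N) :
  rollout z (nxt k) =
  dyn P (rollout z (cur k), control z k, th) - state z (nxt k).
Proof. by rewrite -[nat_of_ord (nxt k)]/((val k).+1) /= valK. Qed.

Lemma differentiable_rollout z n : differentiable (fun z => rollout z n) z.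
Proof.
elim: n z => [|n IH] z /=.
  apply: differentiableB; first exact: differentiable_cst.
  exact: differentiable_state.
case: insubP => [k _ _|_]; last exact: differentiable_cst.
apply: differentiableB; last exact: differentiable_state.
by apply: (differentiable_dyn k) => //; exact: differentiable_control.
Qed.

Definition residuals (z : Z) : Z := pack (defect z) (control z) (multiplier z).

(** Subtracting the residual from the propagated state returns the original
    state, at every stage. *)
Lemma rollout_residuals z (k : 'I_N.+1) : rollout (residuals z) k = state z k.
Proof.
case: k => k; elim: k => [|k IH] kN.
  rewrite /= state_pack /defect unlift_none subKr; congr state; exact: val_inj.
have kN' : (k < N)%N by [].
have -> : Ordinal kN = nxt (Ordinal kN') by exact: val_inj.
have cE : cur (Ordinal kN') = Ordinal (ltnW kN) by exact: val_inj.
by rewrite rolloutS cE IH state_pack control_pack /defect liftK cE subKr.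
Qed.

(** * Existence of multipliers *)

(** The derivative at a solution of the value of the perturbed problem splits
    into its part along the controls, zero by minimality, and its part along the
    perturbations, which defines the multipliers up to sign. *)
Theorem multipliers_exist x u : solution P x u th ->
  exists lam : 'I_N.+1 -> 'rV[R]_nx, gradL P (pack x u lam) th = 0.
Proof.
move=> [[xdyn x0] xmin].
pose value (z : Z) : R :=
  cost P (fun k : 'I_N.+1 => rollout z k) (control z) th.
have dvalue z : differentiable value z.
  apply: differentiable_cost => k; first exact: differentiable_rollout.
  exact: differentiable_control.
(* The value function ignores multipliers, so it is differentiated at zero
   multipliers; this lets [lam] be defined from that derivative. *)
pose z0 : Z := pack x u (fun=> 0).
pose zeta := residuals z0.
have defect0 z k : state z = x -> control z = u -> defect z k = 0.
  move=> sz cz; rewrite /defect sz cz.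
  by case: unliftP => [j _|_]; rewrite ?xdyn ?x0 subrr.
have cost_value z : cost P (state z) (control z) th = value (residuals z).
  rewrite /value control_pack; congr (cost P _ _ th); apply/funext => k.
  by rewrite rollout_residuals.
(* Directions with zero state slots leave the constraints unperturbed, so the
   value along them is the cost of a feasible trajectory. *)
have value_control w : state w = (fun=> 0) -> 'd value zeta w = 0.
  move=> sw; apply: diff_eq0_at_min => // t.
  rewrite -cost_value state_pack control_pack; apply: xmin.
  have s0 k : state (zeta + t *: w) k = 0.
    rewrite addrC state_linear sw scaler0 add0r state_pack.
    rewrite defect0 ?state_pack//.
    by rewrite control_pack.
  split=> [k|]; first by rewrite rolloutS s0 subr0.
  by rewrite /= s0 subr0.
pose shift k (v : 'rV[R]_nx) : Z :=
  pack (fun j => if j == k then v else 0) (fun=> 0) (fun=> 0).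
pose lam k : 'rV[R]_nx := - \row_i 'd value zeta (shift k (delta_mx 0 i)).
have lamE k v : dot (lam k) v = - 'd value zeta (shift k v).
  have lshift : linear (shift k).
    move=> c v1 v2; rewrite /shift -pack_linear; congr pack; apply/funext => j.
    - by case: eqP => // _; rewrite scaler0 addr0.
    - by rewrite scaler0 addr0.
    - by rewrite scaler0 addr0.
  pose sM := GRing.isLinear.Build _ _ _ _ _ lshift.
  pose sL : {linear 'rV[R]_nx -> Z} := HB.pack (shift k) sM.
  rewrite /dot mulNmx mxE mxE; congr (- _).
  rewrite [in RHS](row_sum_delta v) -[shift k]/(sL : _ -> _) !linear_sum.
  apply: eq_bigr => i _.
  have -> : sL (v 0 i *: delta_mx 0 i) = v 0 i *: sL (delta_mx 0 i).
    exact: linearZZ.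
  by rewrite linearZ /= !mxE mulrC.
exists lam.
pose ell (z : Z) : R := \sum_k dot (lam k) (state z k).
pose W (z : Z) : R := value z + ell z.
have ell_linear : linear ell.
  move=> c z z'; rewrite /ell scaler_sumr -big_split; apply: eq_bigr => k _.
  by rewrite state_linear dot_linear.
have dell z : is_diff z ell ell by exact: rV_linear_is_diff.
have dW z : is_diff z W (fun w => 'd value z w + ell w).
  exact: is_diffD (differentiableP (dvalue z)) (dell z).
have W0 w : 'd W zeta w = 0.
  rewrite (diff_val (is_diff_def := dW _)).
  pose w1 : Z := pack (state w) (fun=> 0) (fun=> 0).
  pose w2 : Z := pack (fun=> 0) (control w) (multiplier w).
  have wE : w = w1 + w2.
    rewrite -[w1]scale1r -pack_linear -[LHS]unpackK; congr pack;
    by apply/funext => k; rewrite ?scaler0 ?scale1r ?addr0 ?add0r.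
  have -> : ell w = - 'd value zeta w1.
    rewrite /w1 pack_sum_states linear_sum -sumrN /=.
    by apply: eq_bigr => k _; rewrite lamE.
  by rewrite {1}wE linearD /= (value_control w2) ?addr0 ?subrr// state_pack.
have dresiduals z : differentiable residuals z.
  apply: differentiable_pack => k; first exact: differentiable_defect.
    exact: differentiable_control.
  exact: differentiable_multiplier.
(* With the multipliers fixed at [lam], the Lagrangian is [W \o residuals]. *)
have primal w : multiplier w = (fun=> 0) ->
    'D_w (fun z => lagrangian P z th) (pack x u lam) = 0.
  move=> mw.
  have -> : 'D_w (fun z => lagrangian P z th) (pack x u lam) =
      'D_w (W \o residuals) z0.
    apply: derive_eq_line => t; rewrite lagrangianE /W /ell /=.
    set z := _ + pack x u lam; set z' := _ + z0.
    have sE : state z = state z'.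
      by apply/funext => k; rewrite !state_linear !state_pack.
    have cE : control z = control z'.
      by apply/funext => k; rewrite !control_linear !control_pack.
    have mE : multiplier z = lam.
      apply/funext => k.
      by rewrite multiplier_linear mw multiplier_pack scaler0 add0r.
    rewrite sE cE mE cost_value state_pack; congr (_ + _).
    by apply: eq_bigr => k _; rewrite /defect sE cE.
  have dWr := ex_diff (is_diff_def := dW zeta).
  rewrite deriveE; last exact: differentiable_comp.
  by rewrite diff_comp//= W0.
(* With states and controls fixed at a feasible trajectory, the Lagrangian is
   constant. *)
have dual w : state w = (fun=> 0) -> control w = (fun=> 0) ->
    'D_w (fun z => lagrangian P z th) (pack x u lam) = 0.
  move=> sw cw.
  rewrite -[RHS](derive_cst (cost P x u th) (0 : Z) w).
  apply: derive_eq_line => t; rewrite lagrangianE /=; set z := _ *: w + _.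
  have sE : state z = x.
    by apply/funext => k; rewrite state_linear sw state_pack scaler0 add0r.
  have cE : control z = u.
    by apply/funext => k; rewrite control_linear cw control_pack scaler0 add0r.
  rewrite sE cE big1 ?addr0// => k _.
  by rewrite defect0// dot0r.
apply/rowP => i; rewrite !mxE.
set w := delta_mx 0 i : Z.
pose w1 : Z := pack (state w) (control w) (fun=> 0).
pose w2 : Z := pack (fun=> 0) (fun=> 0) (multiplier w).
have -> : w = w1 + w2.
  rewrite -[w1]scale1r -pack_linear -[LHS]unpackK; congr pack;
  by apply/funext => k; rewrite ?scaler0 ?scale1r ?addr0 ?add0r.
have dL v := deriveE v (L_diff (pack x u lam)).
rewrite dL linearD /= -(dL w1) -(dL w2) primal ?multiplier_pack//.
by rewrite dual ?addr0 ?state_pack ?control_pack.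
Qed.

End Optimality.

(** * Sensitivity of the solution *)

(** What remains is a transposition: [jacobian] acts on rows from the right,
    [jac] on columns from the left. *)
Theorem proposition3 (R : realType) (nx nu nt N : nat) (P : ocp R nx nu nt)
  (init_diff : forall th : 'rV[R]_nt, differentiable (init P) th)
  (L_diff : forall (z : 'rV[R]_(nz nx nu N)) (th : 'rV[R]_nt),
     differentiable (fun z' => lagrangian P z' th) z)
  (gradL_C1 : continuously_differentiable
     (fun p : 'rV[R]_(nz nx nu N) * 'rV[R]_nt => gradL P p.1 p.2))
  (th0 : 'rV[R]_nt)
  (x : 'I_N.+1 -> 'rV[R]_nx) (u : 'I_N -> 'rV[R]_nu)
  (sol : solution P x u th0) :
  (exists lam : 'I_N.+1 -> 'rV[R]_nx, gradL P (pack x u lam) th0 = 0) /\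
  (forall lam : 'I_N.+1 -> 'rV[R]_nx,
     gradL P (pack x u lam) th0 = 0 ->
     L_zz P (pack x u lam) th0 \in unitmx ->
     exists zs : 'rV[R]_nt -> 'rV[R]_(nz nx nu N),
       zs th0 = pack x u lam /\
       \forall th \near th0,
         [/\ gradL P (zs th) th = 0,
             L_zz P (zs th) th \in unitmx,
             differentiable zs th &
             jac zs th = - (invmx (L_zz P (zs th) th) *m L_ztheta P (zs th) th)]).
Proof.
split; first exact: (multipliers_exist (L_diff^~ th0) sol).
move=> lam gradL0 L_unit.
pose F (p : 'rV[R]_(nz nx nu N) * 'rV[R]_nt) := gradL P p.1 p.2.
have J_unit : jacobian (fun z => F (z, th0)) (pack x u lam) \in unitmx.
  by rewrite -unitmx_tr.
have := @implicit_function R _ _ F gradL_C1 (pack x u lam) th0 gradL0 J_unit.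
move=> [zs [zs0 zsP]].
exists zs; split=> //; apply: filterS zsP => th [gradL_th unit_th dzs].
have Lzz_unit : L_zz P (zs th) th \in unitmx by rewrite /L_zz /jac unitmx_tr.
split; [exact: gradL_th|exact: Lzz_unit|exact: (ex_diff (is_diff_def := dzs))|].
have := jacobian_val dzs; rewrite /L_zz /L_ztheta /jac => ->.
move: (jacobian _ _) (jacobian _ _) => A B.
by rewrite -trmx_inv -trmx_mul linearN.
Qed.
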